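(* Let $m \geq 2$ and $n \geq 2$ be integers, and let $K_{1(n),m}$ denote the complete $(n+1)$-partite graph having $n$ partite sets of size one and one partite set of size $m$ (equivalently, the join $O_m \vee K_n$ of an edgeless graph on $m$ vertices with the complete graph $K_n$). Then the IC-index of $K_{1(n),m}$ is $$M(K_{1(n),m}) = 2^{m+n} - 2^m + 1.$$
   Context: All graphs are finite and simple. For a connected graph $G$, a coloring of $G$ is a function $f: V(G) \to \mathbb{N}$ (positive integers). For a subgraph $H$ of $G$, write $f(H) = \sum_{v \in V(H)} f(v)$. A coloring $f$ is an IC-coloring of $G$ if for every integer $k \in \{1, 2, \dots, f(G)\}$ there is an induced connected subgraph $H$ of $G$ with $f(H) = k$. The IC-index of $G$ is $M(G) = \max\{f(G) : f \text{ is an IC-coloring of } G\}$. $O_m$ denotes the graph with $m$ vertices and no edges. The join $H_0 \vee H_1$ of disjoint graphs has vertex set $V(H_0) \cup V(H_1)$ and edge set $E(H_0) \cup E(H_1) \cup \{uv : u \in V(H_0), v \in V(H_1)\}$. *)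

(* Defs.v *)
From mathcomp Require Import all_boot.

Set Implicit Arguments.
Unset Strict Implicit.
Unset Printing Implicit Defensive.

Record sgraph := SGraph {
  vertex :> finType;
  adj : rel vertex;
  adj_sym : symmetric adj;
  adj_irrefl : irreflexive adj
}.

Definition connected (G : sgraph) : Prop :=
  0 < #|G| /\ forall x y : G, connect (@adj G) x y.

Section Induced.
Variables (G : sgraph) (S : {set G}).

Definition induced_adj : rel {x : G | x \in S} :=
  fun u v => adj (val u) (val v).

Lemma induced_adj_sym : symmetric induced_adj.
Proof. by move=> u v; rewrite /induced_adj adj_sym. Qed.

Lemma induced_adj_irrefl : irreflexive induced_adj.
Proof. by move=> u; rewrite /induced_adj adj_irrefl. Qed.

Definition induced : sgraph := SGraph induced_adj_sym induced_adj_irrefl.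

End Induced.

(* Colors are positive integers. *)
Definition coloring (G : sgraph) (f : G -> nat) : Prop :=
  forall v : G, 0 < f v.

(* An induced subgraph is given by its vertex set [S]; [weight f S] is f(H). *)
Definition weight (G : sgraph) (f : G -> nat) (S : {set G}) : nat :=
  \sum_(v in S) f v.

Definition IC_coloring (G : sgraph) (f : G -> nat) : Prop :=
  coloring f /\
  forall k : nat, 1 <= k <= weight f [set: G] ->
    exists2 S : {set G}, connected (induced S) & weight f S = k.

(* M(G) = M. The index is a relation because a disconnected graph may have
   no IC-coloring at all, in which case the maximum does not exist. *)
Definition is_IC_index (G : sgraph) (M : nat) : Prop :=
  (exists2 f : G -> nat, IC_coloring f & weight f [set: G] = M) /\
  forall f : G -> nat, IC_coloring f -> weight f [set: G] <= M.

Section Multipartite.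
Variables (k : nat) (s : 'I_k -> nat).

(* A vertex is a pair of a part [i] and an element of that part. *)
Definition multipartite_adj : rel {i : 'I_k & 'I_(s i)} :=
  fun u v => tag u != tag v.

Lemma multipartite_adj_sym : symmetric multipartite_adj.
Proof. by move=> u v; rewrite /multipartite_adj eq_sym. Qed.

Lemma multipartite_adj_irrefl : irreflexive multipartite_adj.
Proof. by move=> u; rewrite /multipartite_adj eqxx. Qed.

Definition complete_multipartite : sgraph :=
  SGraph multipartite_adj_sym multipartite_adj_irrefl.

End Multipartite.

(* K_{1(n),m}: parts 0, ..., n-1 have size 1 and part n has size m. *)
Definition K1nm (n m : nat) : sgraph :=
  complete_multipartite (fun i : 'I_n.+1 => if i < n then 1 else m).

Definition graph_iso (G H : sgraph) : Prop :=
  exists2 h : G -> H, bijective h & forall x y, adj (h x) (h y) = adj x y.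

Section Join.
Variables G H : sgraph.

Definition join_adj : rel (G + H)%type := fun u v =>
  match u, v with
  | inl x, inl y => adj x y
  | inr x, inr y => adj x y
  | _, _ => true
  end.

Lemma join_adj_sym : symmetric join_adj.
Proof. by case=> x [] y //=; rewrite adj_sym. Qed.

Lemma join_adj_irrefl : irreflexive join_adj.
Proof. by case=> x /=; rewrite adj_irrefl. Qed.

Definition join : sgraph := SGraph join_adj_sym join_adj_irrefl.

End Join.

Lemma edgeless_sym (m : nat) : symmetric (fun _ _ : 'I_m => false).
Proof. by []. Qed.

Lemma edgeless_irrefl (m : nat) : irreflexive (fun _ _ : 'I_m => false).
Proof. by []. Qed.

Definition edgeless (m : nat) : sgraph :=
  SGraph (@edgeless_sym m) (@edgeless_irrefl m).

Lemma complete_sym (n : nat) : symmetric (fun x y : 'I_n => x != y).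
Proof. by move=> x y; rewrite eq_sym. Qed.

Lemma complete_irrefl (n : nat) : irreflexive (fun x y : 'I_n => x != y).
Proof. by move=> x; rewrite eqxx. Qed.

Definition complete (n : nat) : sgraph :=
  SGraph (@complete_sym n) (@complete_irrefl n).

Lemma K1nm_join (n m : nat) : graph_iso (join (edgeless m) (complete n)) (K1nm n m).
Proof.
pose s (i : 'I_n.+1) := if i < n then 1 else m.
have sm : m = s ord_max by rewrite /s /= ltnn.
have s1 (i : 'I_n) : 1 = s (widen_ord (leqnSn n) i) by rewrite /s /= ltn_ord.
pose h (u : 'I_m + 'I_n) : {i : 'I_n.+1 & 'I_(s i)} :=
  match u with
  | inl x => Tagged (fun i => 'I_(s i)) (cast_ord sm x)
  | inr y => Tagged (fun i => 'I_(s i)) (cast_ord (s1 y) ord0)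
  end.
exists h; last first.
  case=> x [] y; rewrite /= /multipartite_adj /=.
  - by rewrite eqxx.
  - by rewrite -val_eqE /= gtn_eqF.
  - by rewrite -val_eqE /= ltn_eqF.
  - by rewrite -!val_eqE.
pose g (v : {i : 'I_n.+1 & 'I_(s i)}) : option ('I_m + 'I_n) :=
  if insub (val (tag v)) is Some y then Some (inr y)
  else omap inl (insub (val (tagged v))).
have hK : pcancel h g.
  case=> x; rewrite /g /=; last by rewrite valK.
  by rewrite insubF ?ltnn //= valK.
have h_inj : injective h := pcan_inj hK.
apply: inj_card_bij => //.
rewrite card_sum !card_ord card_tagged sumnE big_map big_enum /=.
rewrite big_ord_recr /= !card_ord ltnn addnC leq_add2l.
rewrite (eq_bigr (fun=> 1)) => [|i _]; last by rewrite card_ord ltn_ord.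
by rewrite sum1_card card_ord.
Qed.

(* Main.v *)
(** Let [K] be the clique part. A nonempty vertex set induces a connected
    subgraph iff it meets [K] ("hitting") or is a singleton, and there are
    2^(m+n) - 2^m hitting sets.

    Upper bound: call a value exclusive if it is attained by a vertex but by no
    hitting set. If there are e exclusive values, it suffices to discard e - 1
    hitting sets whose weights are still attained by the remaining ones. Let M
    be the largest exclusive value, c its vertex, k another exclusive value and
    v its vertex. A connected Z with f(Z) = k + M avoids both v and c. If Z does
    not contain K, discard the complement of {v, c}, as the complement of Z has
    the same weight. If Z contains K, pick b in K with f(b) <= 2 and discard
    Z - b: for k > f(b), any connected S with f(S) = k - f(b) contains b, and
    S + c replaces Z - b. If K has no color below 3, then colors 1, 2, 3
    all occur and 1 + 2 = 3 already yields enough coincidences.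

    Lower bound: with B = 2^n - 1, color K by 1, 2, ..., 2^(n-1) and the other
    part by B, 2B, ..., 2^(m-2) B, 2^(m-1) B + 1; the weights of the hitting
    sets fill intervals of length B and miss only 2^(m-1) B + 1. *)
Require Import Defs.
From mathcomp Require Import all_boot zify.

Set Implicit Arguments.
Unset Strict Implicit.
Unset Printing Implicit Defensive.

(** * Additivity of color sums over vertex sets *)

Section Weight.
Variables (G : sgraph) (f : G -> nat).
Implicit Types (S A B : {set G}) (v : G).

Lemma weight1 v : weight f [set v] = f v.
Proof. by rewrite /weight big_set1. Qed.

Lemma weight_setU A B : [disjoint A & B] ->
  weight f (A :|: B) = weight f A + weight f B.
Proof. by move=> dAB; rewrite /weight -bigU //; apply: eq_bigl => x; rewrite !inE. Qed.

Lemma weight_setU1 v S : v \notin S -> weight f (v |: S) = f v + weight f S.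
Proof. by move=> vS; rewrite /weight big_setU1. Qed.

Lemma weight_setD1 v S : v \in S -> weight f S = f v + weight f (S :\ v).
Proof. by move=> vS; rewrite /weight (big_setD1 v). Qed.

Lemma weight_setC S : weight f (~: S) + weight f S = weight f [set: G].
Proof.
by rewrite -weight_setU ?[_ :|: S]setUC ?setUCr // disjoints_subset.
Qed.

Lemma weightS A B : A \subset B -> weight f A <= weight f B.
Proof.
by move=> sAB; rewrite /weight [leqRHS](big_setID A) /= (setIidPr sAB) leq_addr.
Qed.

Lemma weight_mem v S : v \in S -> f v <= weight f S.
Proof. by move/weight_setD1->; apply: leq_addr. Qed.

End Weight.

(** * Upper bound, with hitting sets and singletons in place of connected sets *)

Section UpperBound.
Variables (G : sgraph) (K : {set G}) (f : G -> nat).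
Hypothesis f_gt0 : coloring f.
Local Notation w := (weight f).
Local Notation T := (w [set: G]).

Definition hitting : {set {set G}} := [set S : {set G} | ~~ [disjoint S & K]].

Hypothesis values_hit : forall k, 1 <= k <= T ->
  exists2 S : {set G}, S \in hitting \/ exists v, S = [set v] & w S = k.

Lemma hittingP (S : {set G}) : reflect (exists2 v, v \in S & v \in K) (S \in hitting).
Proof.
rewrite inE -setI_eq0; apply: (iffP (set0Pn _)) => [[v]|[v vS vK]].
  by rewrite inE => /andP[vS vK]; exists v.
by exists v; rewrite inE vS.
Qed.

Lemma card_hitting : #|hitting| = 2 ^ #|G| - 2 ^ #|~: K|.
Proof.
rewrite -card_powerset -cardsT -card_powerset powersetT.
have -> : hitting = ~: powerset (~: K).
  by apply/setP => S; rewrite !inE disjoints_subset.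
by rewrite [in RHS]cardsT -(cardsC (powerset (~: K))) addKn.
Qed.

Definition exclusive (k : nat) : bool :=
  [exists v, f v == k] && [forall S in hitting, w S != k].

Definition exclusives : {set 'I_T.+1} := [set k : 'I_T.+1 | exclusive k].

Lemma exclusive_not_hit k (S : {set G}) : exclusive k -> S \in hitting -> w S <> k.
Proof. by case/andP=> _ /forall_inP h /h /eqP. Qed.

Lemma exclusive_notin k v : exclusive k -> f v = k -> v \notin K.
Proof.
move=> ek fv; apply/negP => vK; apply: (@exclusive_not_hit k [set v]) => //.
  by apply/hittingP; exists v; rewrite ?set11.
by rewrite weight1.
Qed.

Lemma exclusive_vertex k : exclusive k -> {v | f v = k & v \notin K}.
Proof.
move=> ek; have /andP[/existsP/sigW[v /eqP fv] _] := ek.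
by exists v => //; apply: exclusive_notin fv.
Qed.

Lemma exclusive_gt0 k : exclusive k -> 0 < k.
Proof. by case/exclusive_vertex => v <- _. Qed.

(** An exclusive value is the color of a vertex outside [K], since a singleton inside [K] is a
    hitting set. *)
Lemma card_exclusives : #|exclusives| <= #|~: K|.
Proof.
have le_fT v : f v < T.+1 by rewrite ltnS -weight1 weightS ?subsetT.
apply: leq_trans (leq_imset_card (fun v => Ordinal (le_fT v)) (mem (~: K))).
apply/subset_leq_card/subsetP => k; rewrite inE => /exclusive_vertex[v fv vK].
by apply/imsetP; exists v; [rewrite inE | apply: val_inj].
Qed.

(** Each value from 1 to [T] is exclusive or the weight of a hitting set, which the replacements
    allow to be taken outside [R]. *)
Lemma total_le_hitting (R : {set {set G}}) : R \subset hitting ->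
  (forall S, S \in R -> exists2 S', S' \in hitting :\: R & w S' = w S) ->
  T + #|R| <= #|hitting| + #|exclusives|.
Proof.
move=> sR repl.
have -> : #|hitting| = #|hitting :\: R| + #|R|.
  by rewrite -(cardsID R hitting) (setIidPr sR) addnC.
rewrite -addnA [#|R| + _]addnC addnA leq_add2r.
have cT : #|[set~ (ord0 : 'I_T.+1)]| = T by rewrite cardsC1 card_ord.
apply: leq_trans (eq_leq (esym cT)) _; apply: (@leq_trans
  #|[set (inord (w S) : 'I_T.+1) | S in hitting :\: R] :|: exclusives|); last first.
  by apply: leq_trans (leq_card_setU _ _) _; rewrite leq_add2r leq_imset_card.
apply/subset_leq_card/subsetP => k; rewrite !inE => k0.
have [ek|nek] := boolP (exclusive k); first by rewrite orbT.
rewrite orbF.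
have hk : exists2 S, S \in hitting & w S = k.
  have [] := @values_hit k; first by rewrite lt0n k0 -ltnS ltn_ord.
  move=> S [hS|[v ->]] wS; first by exists S.
  move: nek; rewrite negb_and => /orP[/existsPn/(_ v)|].
    by rewrite -wS weight1 eqxx.
  by case/forall_inPn=> S' hS'; rewrite negbK => /eqP wS'; exists S'.
case: hk => S hS wS; have [SR|SR] := boolP (S \in R).
  have [S' hS' wS'] := repl S SR; apply/imsetP; exists S' => //.
  by rewrite wS' wS inord_val.
by apply/imsetP; exists S; rewrite ?wS ?inord_val // in_setD SR.
Qed.

(** Otherwise, removing [v] would leave a hitting set of weight [k]. *)
Lemma sub_exclusive_vertex k v (S : {set G}) : exclusive k -> v \in S -> v \notin K ->
  w S = f v + k -> S \notin hitting.
Proof.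
move=> ek vS vK wS; apply/hittingP => -[x xS xK].
apply: (@exclusive_not_hit k (S :\ v)) => //.
  by apply/hittingP; exists x; rewrite // !inE xS andbT; apply: contraNneq vK => <-.
by move: (weight_setD1 f vS); lia.
Qed.

(** A set of weight [i + j] through [u] or [v] cannot hit [K], and as a singleton it would weigh
    only [i] or [j]. *)
Lemma exclusive_sum i j u v : exclusive i -> exclusive j -> u != v ->
  f u = i -> f v = j -> u \notin K -> v \notin K ->
  exists S, [/\ S \in hitting \/ exists x, S = [set x], w S = i + j,
    u \notin S & v \notin S].
Proof.
move=> ei ej uv fu fv uK vK.
have uv' : u \notin [set v] by rewrite inE.
have [|S cS wS] := @values_hit (i + j).
  rewrite addn_gt0 exclusive_gt0 //= -fu -fv -(weight1 f v) -weight_setU1 //.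
  by rewrite weightS ?subsetT.
have avoid k x : exclusive k -> x \notin K -> w S = f x + k -> x \notin S.
  move=> ek xK wSx; apply/negP => xS.
  have nS := sub_exclusive_vertex ek xS xK wSx.
  case: cS => [hS|[y Sy]]; first by rewrite hS in nS.
  move: xS wSx; rewrite Sy inE => /eqP <-; rewrite weight1.
  by have := exclusive_gt0 ek; lia.
exists S; split=> //; [apply: (avoid j)|apply: (avoid i)] => //; lia.
Qed.

(** A set of weight [k - f b] without [b] would, once [b] is added, hit [K] with weight [k]. *)
Lemma exclusive_sub k b : exclusive k -> b \in K -> f b < k -> k <= T ->
  exists S, [/\ S \in hitting, b \in S & w S = k - f b].
Proof.
move=> ek bK bk kT; have [|S _ wS] := @values_hit (k - f b); first lia.
have bS : b \in S.
  apply/negPn/negP => bS; apply: (@exclusive_not_hit k (b |: S)) => //.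
    by apply/hittingP; exists b; rewrite ?setU11.
  by rewrite weight_setU1 // wS; lia.
by exists S; split=> //; apply/hittingP; exists b.
Qed.

Lemma singleton_value k : (forall b, b \in K -> k < f b) -> 1 <= k <= T ->
  exists2 u, u \notin K & f u = k.
Proof.
move=> kK kT; have [S [/hittingP[b bS bK]|[v ->]] wS] := values_hit kT.
  by have := kK b bK; have := weight_mem f bS; lia.
exists v; last by rewrite -wS weight1.
by apply/negP => /kK; rewrite -wS weight1 ltnn.
Qed.

(** * Redundant families of hitting sets *)

Definition redundant (R : {set {set G}}) : Prop := R \subset hitting /\
  forall S, S \in R -> exists2 S', S' \in hitting :\: R & w S' = w S.

(* The vertices of colors 1 and 2 together weigh as much as the vertex of
   color 3, so every hitting set containing the first two but not the third
   can be replaced. *)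
Lemma redundant_large : 1 < #|K| -> (forall b, b \in K -> 2 < f b) ->
  exists2 R, redundant R & #|exclusives| <= #|R| + 1.
Proof.
move=> K2 fK; have /card_gt0P[b0 b0K] : 0 < #|K| by apply: ltnW.
have T3 : 3 <= T by apply: leq_trans (fK _ b0K) (weight_mem _ (in_setT b0)).
have [u1 u1K fu1] : exists2 u, u \notin K & f u = 1.
  by apply: singleton_value => [b /fK|]; lia.
have [u2 u2K fu2] : exists2 u, u \notin K & f u = 2.
  by apply: singleton_value => [b /fK|]; lia.
have [z fz] : exists z, f z = 3.
  have [|S [/hittingP[b bS bK]|[v ->]] wS] := @values_hit 3; first lia.
    by exists b; have := fK b bK; have := weight_mem f bS; lia.
  by exists v; rewrite -wS weight1.
have u12 : u1 != u2 by apply: contra_eq_neq fu1 => ->; rewrite fu2.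
have u1z : u1 != z by apply: contra_eq_neq fu1 => ->; rewrite fz.
have u2z : u2 != z by apply: contra_eq_neq fu2 => ->; rewrite fz.
(* Taking [b = z] when [z] lies in [K] prevents [z] and [x] from being two distinct vertices of
   [K]. *)
pose b := if z \in K then z else b0.
have bK : b \in K by rewrite /b; case: ifP.
pose X := b |: (~: K :\ u1) :\ u2.
have cX : #|exclusives| <= #|X| + 1.
  apply: leq_trans card_exclusives _.
  rewrite cardsU1 !inE bK !andbF /= (cardsD1 u1 (~: K)) (cardsD1 u2 (_ :\ u1)).
  by rewrite !inE u1K u2K eq_sym u12 /=; lia.
have Xu x : x \in X -> x != u1 /\ x != u2.
  rewrite !inE => /orP[/eqP->|/and3P[-> ->]//].
  by split; apply: contraTneq bK => ->.
have XK x : x \in X -> exists2 c, c \in K & c \notin [set z; x].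
  move=> xX.
  have : 0 < #|K :\: [set z; x]|.
    suff: #|K :&: [set z; x]| <= 1 by have := cardsID [set z; x] K; lia.
    have [zK|zK] := boolP (z \in K).
      apply: (@leq_trans #|[set z]|); last by rewrite cards1.
      apply/subset_leq_card/subsetP => y; rewrite !inE => /andP[yK /orP[//|/eqP yx]].
      move: xX yK; rewrite yx !inE /b zK => /orP[//|/and3P[_ _ /negPf->]].
      by [].
    apply: (@leq_trans #|[set x]|); last by rewrite cards1.
    apply/subset_leq_card/subsetP => y; rewrite !inE => /andP[yK /orP[/eqP yz|//]].
    by rewrite yz (negPf zK) in yK.
  by case/card_gt0P => c; rewrite inE => /andP[cX' cK]; exists c.
(* The case [x = z] is allowed; the set then omits a single vertex. *)
pose r x := ~: [set z; x].
exists [set r x | x in X]; last first.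
  rewrite card_in_imset // => x y xX yX /setC_inj exy.
  have [xz|xz] := eqVneq x z; last first.
    have : x \in [set z; y] by rewrite -exy !inE eqxx orbT.
    by rewrite !inE (negPf xz) => /eqP.
  have : y \in [set z; x] by rewrite exy !inE eqxx orbT.
  by rewrite !inE xz orbb => /eqP->.
split; first apply/subsetP => S.
  case/imsetP => x xX ->; have [c cK cX'] := XK x xX.
  by apply/hittingP; exists c => //; rewrite in_setC.
move=> _ /imsetP[x xX ->]; have [c cK cX'] := XK x xX.
have [xu1 xu2] := Xu x xX.
exists (z |: (r x :\ u1) :\ u2).
  rewrite in_setD; apply/andP; split.
    apply/negP => /imsetP[y yX] /setP/(_ z).
    by rewrite !inE eqxx.
  apply/hittingP; exists c => //; rewrite !inE; rewrite !inE in cX'.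
  rewrite cX' andbT orbC -[_ && _]/(_ && (c != u1)).
  by case: eqP => [cu|_]; [|case: eqP => [cu|//]]; rewrite -cu cK in u2K u1K.
rewrite weight_setU1; last by rewrite !inE eqxx !andbF.
rewrite (@weight_setD1 _ f u1 (r x)) ?(@weight_setD1 _ f u2 (r x :\ u1)).
- by lia.
- by rewrite !inE negb_or eq_sym u12 u2z eq_sym xu2.
- by rewrite !inE negb_or u1z eq_sym xu1.
Qed.

Definition replaced_by (b : G) (A : {set G}) : Prop :=
  exists B : {set G}, [/\ B \in hitting, b \in B & w B = w A].

(* The three forms of the discarded set [A] make it determine [k]. When [k] is
   below [f b] (so [k = 1] and [f b = 2]), the substitute for [A] may itself be
   discarded, but it contains [b], hence it has a substitute containing [c]. *)
Lemma redundant_step M c k b : exclusive M -> exclusive k -> k < M ->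
  f c = M -> b \in K -> f b <= 2 -> 1 < #|K| ->
  exists A : {set G}, [/\ A \in hitting, c \notin A,
    [\/ exists2 u, f u = k & A = ~: [set u; c],
        A = ~: [set c] /\ k = 1 | b \notin A /\ w A + f b = k + M] &
    replaced_by c A \/ b \notin A /\ replaced_by b A].
Proof.
move=> eM ek kM fc bK fb K2.
have cK := exclusive_notin eM fc.
have MT : M <= T by rewrite -fc; apply: weight_mem; rewrite in_setT.
have [v fv vK] := exclusive_vertex ek.
have vc : v != c by apply: contra_eq_neq fv => ->; rewrite fc neq_ltn kM orbT.
have k0 := exclusive_gt0 ek.
have [Z [cZ wZ vZ cZ']] := exclusive_sum ek eM vc fv fc vK cK.
have [/subsetP KZ|] := boolP (K \subset Z); last first.
  case/subsetPn => d dK dZ; exists (~: [set v; c]); split.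
  - apply/hittingP; exists b => //; rewrite !inE.
    by apply/norP; split; apply: contraTneq bK => ->.
  - by rewrite !inE eqxx orbT.
  - by constructor 1; exists v.
  (* [Z] and the pair [v], [c] both weigh [k + M], so their complements have equal weight. *)
  left; exists (~: Z); split; last 2 first.
  - by rewrite inE.
  - have := weight_setC f Z; have := weight_setC f [set v; c].
    by rewrite weight_setU1 ?inE // weight1; lia.
  by apply/hittingP; exists d; rewrite ?inE.
have bZ := KZ b bK.
have [A AE] : exists A, A = Z :\ b by exists (Z :\ b).
have wA : w A + f b = k + M by have := weight_setD1 f bZ; rewrite -AE; lia.
have bA : b \notin A by rewrite AE !inE eqxx.
have cA : c \notin A by rewrite AE !inE negb_and cZ' orbT.
have hA : A \in hitting.
  have : 0 < #|K :\ b| by move: K2; rewrite (cardsD1 b) bK.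
  case/card_gt0P => d; rewrite in_setD1 => /andP[db dK].
  by apply/hittingP; exists d; rewrite // AE !inE db KZ.
have [bk|kb] := ltnP (f b) k.
  have kT : k <= T by apply: leq_trans (ltnW kM) MT.
  have [S [hS bS wS]] := exclusive_sub ek bK bk kT.
  exists A; split=> //; first by constructor 3.
  left; have cS : c \notin S.
    by apply/negP => /(weight_mem f); rewrite fc wS => h; clear -h kM; lia.
  exists (c |: S); split; rewrite ?setU11 //.
    by apply/hittingP; exists b; rewrite // !inE bS orbT.
  by rewrite weight_setU1 // wS fc; clear -wA bk; lia.
(* An exclusive value is no color of [K]; with [f b <= 2] this leaves only [k = 1] and [f b = 2]. *)
have kb' : k != f b.
  by apply: contraTneq bK => /esym fbk; apply: exclusive_notin fbk.
have [k1 fb2] : k = 1 /\ f b = 2.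
  by clear -kb kb' k0 fb; split; lia.
(* [M - 1] is now the weight of [A]. If [S] avoids [b], then trading [v] for [b], or adding [v] to a
   hitting [S], would make [M] hit. What remains is a singleton [l] with [f v + f l = f c]. *)
have [|S hS wS] := @values_hit (M - 1); first by clear -MT kM k0; lia.
have [bS|bS] := boolP (b \in S).
  exists A; split=> //; first by constructor 3.
  right; split=> //; exists S; split=> //; last by clear -wA wS k1 fb2; lia.
  by apply/hittingP; exists b.
have [vS|vS] := boolP (v \in S).
  case: (@exclusive_not_hit M (b |: S :\ v)) => //.
    by apply/hittingP; exists b; rewrite ?setU11.
  rewrite weight_setU1; last by rewrite inE negb_and bS orbT.
  by have := weight_setD1 f vS; clear -wS kM fv fb2 k1; lia.
case: hS => [/hittingP[d dS dK]|[l Sl]].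
  case: (@exclusive_not_hit M (v |: S)) => //.
    by apply/hittingP; exists d; rewrite // inE dS orbT.
  by rewrite weight_setU1 // wS; clear -kM fv k1; lia.
move: wS vS bS; rewrite Sl weight1 !inE => fl vl bl.
exists (~: [set c]); split.
- by apply/hittingP; exists b; rewrite // !inE; apply: contraTneq bK => ->.
- by rewrite !inE eqxx.
- by constructor 2.
left; exists (~: [set v; l]); split.
- apply/hittingP; exists b; rewrite // !inE negb_or bl andbT.
  by apply: contraTneq bK => ->.
- rewrite !inE negb_or eq_sym vc /=; apply/eqP => cl.
  by move: fl; rewrite -cl fc; clear -kM; lia.
have := weight_setC f [set c]; have := weight_setC f [set v; l].
by rewrite weight_setU1 ?inE // !weight1; clear -fl fv k1 kM fc; lia.
Qed.

Lemma redundant_small b : 1 < #|K| -> b \in K -> f b <= 2 ->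
  exists2 R, redundant R & #|exclusives| <= #|R| + 1.
Proof.
move=> K2 bK fb.
have [E0|/set0Pn[k0 Ek0]] := eqVneq exclusives set0.
  exists set0; last by rewrite E0 cards0.
  by split; [apply: sub0set | move=> S; rewrite inE].
have [M EM Mmax] := @arg_maxnP _ k0 (mem exclusives) (fun k => val k) Ek0.
have eM : exclusive M by move: EM; rewrite /= inE.
have [c fc _] := exclusive_vertex eM.
have /fin_all_exists[r rP] (k : 'I_T.+1) : exists A : {set G},
    k \in exclusives :\ M -> [/\ A \in hitting, c \notin A,
    [\/ exists2 u, f u = k & A = ~: [set u; c],
        A = ~: [set c] /\ k = 1 :> nat | b \notin A /\ w A + f b = k + M] &
    replaced_by c A \/ b \notin A /\ replaced_by b A].
  (* [set0] is only a default value of the choice function. *)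
  have [kE|kE] := boolP (k \in exclusives :\ M); last by exists set0.
  move: kE; rewrite !inE => /andP[kM ek].
  have ltkM : k < M.
    by rewrite ltn_neqAle val_eqE kM; apply: Mmax; rewrite /= inE.
  have [A PA] := redundant_step eM ek ltkM fc bK fb K2.
  by exists A.
have cK := exclusive_notin eM fc.
have ltEM k : k \in exclusives :\ M -> k < M.
  rewrite !inE => /andP[kM ek]; rewrite ltn_neqAle val_eqE kM.
  by apply: Mmax; rewrite /= inE.
exists [set r k | k in exclusives :\ M]; last first.
  rewrite card_in_imset => [|k k' kE k'E /= rkk'].
    by rewrite (cardsD1 M exclusives) [M \in _]EM addnC.
  have uc j u : j \in exclusives :\ M -> f u = j -> u != c.
    by move=> /ltEM jM fu; apply: contraTneq jM => uc; rewrite -fu uc fc ltnn.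
  have bu j u : j \in exclusives :\ M -> f u = j -> b \in ~: [set u; c].
    rewrite !inE negb_or => /andP[_ ej] fu.
    by apply/andP; split; apply: contraTneq bK => -> //; apply: exclusive_notin fu.
  have bc : b \in ~: [set c] by rewrite !inE; apply: contraTneq bK => ->.
  (* The two complement forms contain [b] and the third does not; among sets of the third form the
     weight determines [k]. *)
  have [_ _ P _] := rP k kE; have [_ _ P' _] := rP k' k'E.
  apply: val_inj; move: P P'; rewrite -rkk' /=.
  case=> [[u fu ->]|[-> k1]|[bA wA]]; case=> [[u' fu']|[]|[]].
  - move/setC_inj/setP/(_ u); rewrite !inE eqxx (negPf (uc _ _ kE fu)) !orbF.
    by case: eqP => // uu _; rewrite -fu -fu' uu.
  - move/setC_inj/setP/(_ u).
    by rewrite !inE eqxx (negPf (uc _ _ kE fu)).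
  - by rewrite (bu _ _ kE fu).
  - move/setC_inj/setP/(_ u').
    by rewrite !inE eqxx (negPf (uc _ _ k'E fu')).
  - by rewrite k1.
  - by rewrite bc.
  - by move=> rk; rewrite rk (bu _ _ k'E fu') in bA.
  - by move=> rk; rewrite rk bc in bA.
  - by move=> _; rewrite wA => /addIn.
split; first by apply/subsetP => _ /imsetP[k kE ->]; case: (rP k kE).
(* No discarded set contains [c], so a substitute through [c] always survives. *)
have cR (B : {set G}) : c \in B -> B \in hitting ->
    B \in hitting :\: [set r k | k in exclusives :\ M].
  move=> cB hB; rewrite inE hB andbT; apply/imsetP => -[k kE Bk].
  by case: (rP k kE) => _; rewrite -Bk cB.
move=> _ /imsetP[k kE ->]; have [_ _ _ [[B [hB cB wB]]|]] := rP k kE.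
  by exists B => //; apply: cR.
case=> bA [B [hB bB wB]].
have [/imsetP[k' kE' Bk']|BR] := boolP (B \in [set r k | k in exclusives :\ M]).
  have [_ _ _ [[B' [hB' cB' wB']]|[]]] := rP k' kE'.
    by exists B'; [apply: cR | rewrite wB' -Bk'].
  by rewrite -Bk' bB.
by exists B; rewrite // inE BR.
Qed.

Lemma total_upper_bound : 1 < #|K| -> T <= 2 ^ #|G| - 2 ^ #|~: K| + 1.
Proof.
move=> K2; rewrite -card_hitting.
have [R [sR rR] eR] : exists2 R, redundant R & #|exclusives| <= #|R| + 1.
  have [/forall_inP|/forall_inPn[b bK]] := boolP [forall b in K, 2 < f b].
    exact: redundant_large.
  by rewrite -leqNgt; apply: redundant_small.
by have := total_le_hitting sR rR; clear -eR; lia.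
Qed.

End UpperBound.

(** * Lower bound: binary colors *)

Section LowerBound.
Variables (V : finType).

(** Binary expansion: by induction, each new vertex receives a color one larger than the sum of the
    previous ones. *)
Lemma binary_weights (A : {set V}) : exists g : V -> nat,
  [/\ forall v, 0 < g v, (\sum_(v in A) g v).+1 = 2 ^ #|A| &
  forall k, k < 2 ^ #|A| -> exists2 S : {set V}, S \subset A & \sum_(v in S) g v = k].
Proof.
elim: {A}_.+1 {-2}A (ltnSn #|A|) => // N IH A; rewrite ltnS => AN.
have [->|/set0Pn[a aA]] := eqVneq A set0.
  exists (fun=> 1); split=> //; first by rewrite big_set0 cards0.
  by rewrite cards0 => -[|//] _; exists set0; rewrite ?sub0set ?big_set0.
have cA : #|A| = #|A :\ a|.+1 by rewrite (cardsD1 a) aA.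
have [|g [g0 gA gk]] := IH (A :\ a); first by rewrite -cA.
pose g' v := if v == a then 2 ^ #|A :\ a| else g v.
have g'E (S : {set V}) : S \subset A :\ a -> \sum_(v in S) g' v = \sum_(v in S) g v.
  move=> /subsetP sS; apply: eq_bigr => v /sS; rewrite !inE /g' => /andP[va _].
  by rewrite (negPf va).
exists g'; rewrite cA expnS mul2n -addnn; split.
- by move=> v; rewrite /g'; case: ifP; rewrite ?expn_gt0.
- by rewrite (big_setD1 a) //= g'E // {1}/g' eqxx -addnS gA.
move=> k kA; have [ltk|lek] := ltnP k (2 ^ #|A :\ a|).
  have [S sS <-] := gk k ltk; exists S; last exact: g'E.
  exact: subset_trans sS (subsetDl _ _).
have [|S sS Sk] := gk (k - 2 ^ #|A :\ a|); first by clear -kA lek; lia.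
exists (a |: S).
  by rewrite subUset sub1set aA (subset_trans sS) ?subsetDl.
rewrite big_setU1 /=; last by apply/negP => /(subsetP sS); rewrite !inE eqxx.
by rewrite g'E // {1}/g' eqxx Sk subnKC.
Qed.

End LowerBound.

(** * Lower bound: the extremal coloring *)

Section OptimalColoring.
Variables (G : sgraph) (K : {set G}).
Hypotheses (K_gt0 : 0 < #|K|) (O_gt0 : 0 < #|~: K|).

Lemma optimal_coloring : exists f : G -> nat,
  [/\ coloring f, weight f [set: G] = 2 ^ #|G| - 2 ^ #|~: K| + 1 &
   forall k, 1 <= k <= weight f [set: G] -> exists2 S : {set G},
     S \in hitting K \/ exists v, S = [set v] & weight f S = k].
Proof.
have [a aK] := card_gt0P O_gt0; set O := ~: K in aK *.
have [g [g0 gK gk]] := binary_weights K.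
have [h [h0 hO hk]] := binary_weights (O :\ a).
(* [B] is the sum of [g] over [K]; below, [J - 1] is the sum of [h] over [O :\ a]. *)
have [B BE] : exists B, B.+1 = 2 ^ #|K| by exists (2 ^ #|K|).-1; rewrite prednK ?expn_gt0.
have [J JE] : exists J, J = 2 ^ #|O :\ a| by eexists.
have B0 : 0 < B.
  have : 2 ^ 1 <= 2 ^ #|K| by rewrite leq_exp2l.
  by rewrite -BE.
have J0 : 0 < J by rewrite JE expn_gt0.
pose f v := if v \in K then g v else if v == a then B * J + 1 else B * h v.
have fK (S : {set G}) : S \subset K -> weight f S = \sum_(v in S) g v.
  by move=> /subsetP sS; apply: eq_bigr => v /sS; rewrite /f => ->.
have fO (S : {set G}) : S \subset O :\ a -> weight f S = B * \sum_(v in S) h v.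
  move=> /subsetP sS; rewrite big_distrr; apply: eq_bigr => v /sS.
  by rewrite !inE /f => /andP[/negPf-> /negPf->].
have faE : f a = B * J + 1.
  by rewrite /f eqxx; move: aK; rewrite inE => /negPf->.
have fT : weight f [set: G] = 2 * (B * J) + 1.
  rewrite -(weight_setC f O) setCK fK // (weight_setD1 f aK) faE fO //.
  move: gK hO; rewrite -BE -JE => -[->] <-; rewrite mulnS mul2n -addnn; clear; lia.
exists f; split.
- move=> v; rewrite /f; case: ifP => // _; case: ifP; first by rewrite addn1.
  by rewrite muln_gt0 B0 h0.
- rewrite fT; congr (_ + 1).
  have -> : #|G| = #|K| + #|O| by rewrite cardsC.
  rewrite expnD -BE (cardsD1 a O) aK expnS -JE.
  by rewrite [B.+1 * _]mulSn addKn mulnCA.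
(* Divide [k - 1] by [B]: the quotient is realized in [O :\ a], the remainder plus one in [K]. The
   shift by one makes the part in [K] nonempty. *)
have low k : 1 <= k <= B * J -> exists2 S : {set G},
    [/\ S \in hitting K & a \notin S] & weight f S = k.
  move=> /andP[k0 kBJ].
  have [|X sX Xk] := hk (k.-1 %/ B).
    by rewrite -JE ltn_divLR // mulnC prednK.
  have [|Y sY Yk] := gk (k.-1 %% B).+1.
    by rewrite -BE ltnS ltn_mod.
  have dXY : [disjoint Y & X].
    apply: disjointWl sY _; rewrite disjoint_sym.
    apply: disjointWl sX _; rewrite disjoints_subset.
    exact: subsetDl.
  exists (Y :|: X); last first.
    rewrite weight_setU // fK // fO // Yk Xk addSn addnC mulnC -divn_eq prednK //.
  split; last first.
    rewrite inE negb_or; apply/andP; split.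
      by apply/negP => /(subsetP sY); apply/negP; rewrite -in_setC.
    by apply/negP => /(subsetP sX); rewrite !inE eqxx.
  have [Y0|/set0Pn[y yY]] := eqVneq Y set0.
    by move: Yk; rewrite Y0 big_set0.
  by apply/hittingP; exists y; [rewrite inE yY | apply: (subsetP sY)].
move=> k; rewrite fT => kT.
have [kl|kg] := leqP k (B * J).
  have [|S [hS _] wS] := low k; first by clear -kl kT; lia.
  by exists S; [left|].
have [->|kn] := eqVneq k (B * J + 1).
  by exists [set a]; [right; exists a | rewrite weight1].
(* Adding [a] translates the values from 1 to [B * J] to those above [B * J + 1]. *)
have [|S [/hittingP[b bS bK] aS] wS] := low (k - (B * J + 1)).
  by clear -kg kn kT; lia.
exists (a |: S); last by rewrite weight_setU1 // wS faE; clear -kg; lia.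
by left; apply/hittingP; exists b; rewrite // inE bS orbT.
Qed.

End OptimalColoring.

(** * Joins of a clique [K] with an edgeless graph *)

Section JoinIndex.
Variables (G : sgraph) (K : {set G}).
Hypothesis adjE : forall u v, adj u v = (u != v) && ((u \in K) || (v \in K)).

(** A vertex of [K] in [S] is adjacent to the rest of [S], whereas a set missing [K] spans no
    edge. *)
Lemma connected_inducedP (S : {set G}) :
  connected (induced S) <-> S \in hitting K \/ exists v, S = [set v].
Proof.
split=> [[S0 cS]|].
  have [hS|nS] := boolP (S \in hitting K); [by left | right].
  have [x _] := card_gt0P S0; exists (val x).
  apply/setP => y; rewrite inE; apply/idP/eqP => [yS|->]; last exact: valP.
  have nK z : z \in S -> z \notin K.
    by move=> zS; apply: contra nS => zK; apply/hittingP; exists z.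
  have /connectP[[|z p] /= ] := cS x (Sub y yS : {x : G | x \in S}).
    by move=> _ <-.
  rewrite /induced_adj adjE.
  by rewrite (negPf (nK _ (valP x))) (negPf (nK _ (valP z))) andbF.
case=> [/hittingP[v vS vK]|[v ->]].
  pose c : induced S := Sub v vS.
  split; first by apply/card_gt0P; exists c.
  have cx x : connect (@adj (induced S)) c x.
    have [<-|cx] := eqVneq c x; first exact: connect0.
    by apply: connect1; rewrite /= /induced_adj adjE /= vK andbT -val_eqE in cx *.
  have sym : connect_sym (@adj (induced S)) by apply: sym_connect_sym; apply: adj_sym.
  by move=> x y; apply: connect_trans (cx y); rewrite sym.
split; first by apply/card_gt0P; exists (Sub v (set11 v)).
move=> x y; have -> : x = y.
  by apply: val_inj; have := valP x; have := valP y; rewrite !inE => /eqP-> /eqP->.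
exact: connect0.
Qed.

Lemma IC_index_join_edgeless : 1 < #|K| -> 0 < #|~: K| ->
  is_IC_index G (2 ^ #|G| - 2 ^ #|~: K| + 1).
Proof.
move=> K2 O0; split.
  have [f [f0 fT fk]] := optimal_coloring (ltnW K2) O0.
  exists f => //; split=> // k /fk[S hS wS].
  by exists S => //; apply/connected_inducedP.
move=> f [f0 fk]; apply: total_upper_bound => // k /fk[S cS wS].
by exists S => //; apply/connected_inducedP.
Qed.

End JoinIndex.

Theorem theorem3p9 (m n : nat) (hm : 2 <= m) (hn : 2 <= n) :
  is_IC_index (K1nm n m) (2 ^ (m + n) - 2 ^ m + 1).
Proof.
have [h h_bij h_adj] := K1nm_join n m; have h_inj := bij_inj h_bij.
(* [K] is the image of the clique side of the join, so its adjacency can be read off there through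
   [h]. *)
pose K : {set K1nm n m} := [set h (inr y) | y : 'I_n].
have hK x : (h x \in K) = if x is inr _ then true else false.
  apply/imsetP/idP => [[y _ /h_inj->]//|]; case: x => // y _.
  by exists y.
have cK : #|K| = n by rewrite card_imset ?card_ord // => x y /h_inj[].
have cG : #|K1nm n m| = m + n.
  by rewrite -(bij_eq_card h_bij) card_sum !card_ord.
have cO : #|~: K| = m by rewrite cardsCs setCK cG cK addnK.
have := @IC_index_join_edgeless _ K; rewrite cK cO cG; apply=> //; last lia.
move=> u v; have [g _ gK] := h_bij; rewrite -(gK u) -(gK v) h_adj !hK.
rewrite (inj_eq h_inj); case: (g u) (g v) => [x|x] [y|y] //=.
  by rewrite andbF.
by rewrite andbT.
Qed.
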